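(* Let $\mathrm{pen}$ be a real-valued polyhedral gauge on $\mathbb{R}^p$ and let $\beta \in \mathbb{R}^p$. Then the complexity of the pattern of $\beta$ with respect to $\mathrm{pen}$ equals the codimension of $\partial_{\mathrm{pen}}(\beta)$; that is, $\dim(\mathrm{lin}(C_\beta)) = p - \dim(\partial_{\mathrm{pen}}(\beta))$.
   Context: A prime denotes transpose. A real-valued polyhedral gauge on $\mathbb{R}^p$ is a function of the form $\mathrm{pen}(b) = \max\{u_1'b,\dots,u_k'b\}$ for some $u_1,\dots,u_k \in \mathbb{R}^p$ with $u_1 = 0$. $\partial_{\mathrm{pen}}(\beta)$ is the subdifferential of $\mathrm{pen}$ at $\beta$; it is a polytope, and its dimension is the dimension of its affine hull. The pattern equivalence class of $\beta$ is $C_\beta = \{b \in \mathbb{R}^p : \partial_{\mathrm{pen}}(b) = \partial_{\mathrm{pen}}(\beta)\}$. The complexity of the pattern of $\beta$ is defined as $\dim(\mathrm{lin}(C_\beta))$, where $\mathrm{lin}$ denotes linear span. *)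

(* Defs.v *)
From HB Require Import structures.
From mathcomp Require Import all_boot all_order all_algebra.
From mathcomp Require Import boolp classical_sets reals.

Set Implicit Arguments.
Unset Strict Implicit.
Unset Printing Implicit Defensive.

Import Order.TTheory GRing.Theory Num.Theory.

Local Open Scope classical_set_scope.
Local Open Scope ring_scope.

Definition dotv (R : realType) (p : nat) (u b : 'cV[R]_p) : R :=
  (u^T *m b) 0 0.

(* The maximum is taken over a nonempty family, and is seeded with its first
   member, so that no extraneous value takes part in it. *)
Definition polyhedral_gauge (R : realType) (p : nat)
    (pen : 'cV[R]_p -> R) : Prop :=
  exists (k : nat) (u : 'I_k.+1 -> 'cV[R]_p),
    u ord0 = 0 /\
    forall b, pen b = \big[Num.max/dotv (u ord0) b]_(i < k.+1) dotv (u i) b.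

Definition subdifferential (R : realType) (p : nat)
    (pen : 'cV[R]_p -> R) (b : 'cV[R]_p) : set 'cV[R]_p :=
  [set s | forall z, pen b + dotv s (z - b) <= pen z].

Definition pattern_class (R : realType) (p : nat)
    (pen : 'cV[R]_p -> R) (beta : 'cV[R]_p) : set 'cV[R]_p :=
  [set b | subdifferential pen b = subdifferential pen beta].

Definition lin (R : realType) (V : lmodType R) (A : set V) : set V :=
  [set x | exists (n : nat) (a : 'I_n -> R) (v : 'I_n -> V),
     (forall i, A (v i)) /\ x = \sum_i a i *: v i].

Definition aff (R : realType) (V : lmodType R) (A : set V) : set V :=
  [set x | exists (n : nat) (a : 'I_n -> R) (v : 'I_n -> V),
     [/\ forall i, A (v i), \sum_i a i = 1 & x = \sum_i a i *: v i]].

Definition translate (R : realType) (V : vectType R) (x : V)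
    (U : {vspace V}) : set V :=
  [set x + y | y in [set` U]].

(* The dimension of an affine subspace x + U (a linear subspace when x = 0) is
   the dimension of its direction U; see [flat_dim_translate].  The value is
   0 on sets that are not affine subspaces; linear spans, and affine hulls of
   nonempty sets, always are: see [lin_flat] and [aff_flat]. *)
Definition flat_dim (R : realType) (V : vectType R) (S : set V) : nat :=
  xget 0%N [set n | exists (x : V) (U : {vspace V}),
                      S = translate x U /\ n = \dim U].

Definition affine_dim (R : realType) (V : vectType R) (A : set V) : nat :=
  flat_dim (aff A).

Definition complexity (R : realType) (p : nat)
    (pen : 'cV[R]_p -> R) (beta : 'cV[R]_p) : nat :=
  flat_dim (lin (pattern_class pen beta)).

Lemma translate_dim (R : realType) (V : vectType R) (x y : V)
    (U W : {vspace V}) : translate x U = translate y W -> U = W.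
Proof.
wlog suff H : x y U W / translate x U = translate y W -> (U <= W)%VS.
  by move=> e; apply: subv_anti; rewrite (H _ _ _ _ e) (H _ _ _ _ (esym e)).
move=> e; apply/subvP => u Uu.
have : translate y W x by rewrite -e; exists 0; rewrite /= ?mem0v ?addr0.
have : translate y W (x + u) by rewrite -e; exists u.
move=> [w /= Ww hw] [w' /= Ww' hw'].
have -> : u = w - w'.
  by rewrite -[u](addKr x) -hw -hw' opprD addrACA addNr add0r addrC.
exact: memvB.
Qed.

Lemma flat_dim_translate (R : realType) (V : vectType R) (x : V)
    (U : {vspace V}) : flat_dim (translate x U) = \dim U.
Proof.
rewrite /flat_dim; case: xgetP => [n _ [y [W [e ->]]]|/(_ (\dim U)) []].
  by rewrite (translate_dim e).
by exists x, U.
Qed.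

Lemma exists_span (R : realType) (V : vectType R) (A : set V) :
  exists s : seq V, (forall x, x \in s -> A x) /\
                    (forall x, A x -> x \in <<s>>%VS).
Proof.
have H n : forall s : seq V, (forall x, x \in s -> A x) ->
    (\dim {:V} - \dim <<s>>%VS <= n)%N ->
    exists s : seq V, (forall x, x \in s -> A x) /\
                      (forall x, A x -> x \in <<s>>%VS).
  elim: n => [|n IH] s sA hn.
    exists s; split=> // x _.
    suff -> : (<<s>> = fullv)%VS by rewrite memvf.
    apply/eqP; rewrite eqEdim subvf /=.
    by rewrite leqn0 subn_eq0 in hn.
  have [h|/existsNP[x /not_implyP[Ax xs]]] :=
    pselect (forall x, A x -> x \in <<s>>%VS); first by exists s.
  apply: (IH (x :: s)).
    by move=> y; rewrite inE => /orP[/eqP->|/sA].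
  have lt : (\dim <<s>>%VS < \dim <<x :: s>>%VS)%N.
    rewrite ltnNge; apply/negP => le; apply: xs.
    have : (<<s>> == <<x :: s>>)%VS.
      by rewrite eqEdim le andbT; apply: sub_span => y; rewrite inE => ->; rewrite orbT.
    by move/eqP->; apply: memv_span; rewrite inE eqxx.
  have := dimvS (subvf <<x :: s>>%VS).
  by move: hn; rewrite !leq_subLR => hn _; apply: (leq_trans hn); rewrite addnS -addSn leq_add2r.
by apply: (H (\dim {:V}) [::]) => //; rewrite leq_subr.
Qed.

Lemma lin_flat (R : realType) (V : vectType R) (A : set V) :
  exists U : {vspace V}, lin A = translate 0 U.
Proof.
have [s [sA As]] := exists_span A; exists <<s>>%VS.
apply/seteqP; split=> [x [n [a [v [Av ->]]]]|x [y /= ys <-]].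
  exists (\sum_i a i *: v i); rewrite /= ?add0r //.
  by apply: memv_suml => i _; apply/memvZ/As.
rewrite add0r; have := @coord_span _ _ _ (in_tuple s) y ys => ->.
exists (size s), (fun i => coord (in_tuple s) i y), (fun i => (in_tuple s)`_i).
by split=> // i; apply: sA; rewrite mem_nth.
Qed.

Lemma aff_flat (R : realType) (V : vectType R) (A : set V) :
  A !=set0 -> exists (x : V) (U : {vspace V}), aff A = translate x U.
Proof.
move=> [x0 Ax0].
have [s [sA As]] := exists_span [set x - x0 | x in A].
exists x0, <<s>>%VS.
apply/seteqP; split=> [x [n [a [v [Av a1 ->]]]]|x [y /= ys <-]].
  exists (\sum_i a i *: (v i - x0)).
    by apply: memv_suml => i _; apply/memvZ/As; exists (v i).
  under eq_bigr do rewrite scalerBr.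
  by rewrite sumrB -scaler_suml a1 scale1r addrC subrK.
have [t tP] : exists t : 'I_(size s) -> V,
    forall i, A (t i) /\ (in_tuple s)`_i = t i - x0.
  have /choice : forall i : 'I_(size s),
      exists w, A w /\ (in_tuple s)`_i = w - x0.
    move=> i; have /sA [w Aw <-] : (in_tuple s)`_i \in s by rewrite mem_nth.
    by exists w.
  by move=> [t tP]; exists t.
have := @coord_span _ _ _ (in_tuple s) y ys.
set c := fun i => coord (in_tuple s) i y => yE.
exists (size s).+1,
  (fun i => if unlift ord0 i is Some j then c j else 1 - \sum_j c j),
  (fun i => if unlift ord0 i is Some j then t j else x0).
split.
- by move=> i; case: unliftP => // j _; case: (tP j).
- rewrite big_ord_recl unlift_none.
  rewrite [X in _ + X](eq_bigr c); first by rewrite subrK.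
  by move=> i _; rewrite liftK.
rewrite big_ord_recl unlift_none.
rewrite [X in _ = _ + X](eq_bigr (fun i => c i *: t i)); last first.
  by move=> i _; rewrite liftK.
rewrite yE scalerBl scale1r -addrA; congr (_ + _).
rewrite scaler_suml addrC -sumrB; apply: eq_bigr => i _.
by rewrite (tP i).2 scalerBr.
Qed.

(* Main.v *)
Require Import Defs.
From HB Require Import structures.
From mathcomp Require Import all_boot all_order all_algebra.
From mathcomp Require Import boolp classical_sets reals.
From mathcomp Require Import lra.

(** Write [pen] as the maximum of finitely many linear forms [u i], call [i]
    active at [b] when [u i] attains the maximum there, fix [i0] active at
    [beta], and let [W] be the span of the differences [u i - u i0] over the
    active [i].  Both dimensions are read off from [W]: the direction of the
    affine hull of the subdifferential is [W], the linear span of the pattern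
    class is the orthogonal complement of [W], and complementary dimensions
    add up to [p].

    The central property of [pen] is local, [active_move]: if all
    active forms take the same value [c] on [v], then for small [t] of either
    sign moving from [beta] to [beta + t v] leaves the active set unchanged
    and [pen] changes by exactly [t c].  It has three uses.
    - The subdifferential is determined by the active set
      ([subdifferential_active_sub], moving past one point away from another
      with the same active set), and conversely the active
      indices are those with [u i] a subgradient ([subgradient_active]).  So
      the pattern class is the set of points with the active set of [beta].
    - If [v] is orthogonal to [W], then [beta + t v] is in the pattern class,
      so [v] is in its span.
    - Along such a [v] the function [pen] is affine near [beta], hence every
      subgradient agrees with [u i0] on [v]; a subgradient thus differs from
      [u i0] by an element of the double orthogonal complement of [W], which
      is [W].
    The description of the subdifferential as a convex hull, which would
    require a separation theorem, is thereby avoided. *)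

Set Implicit Arguments.
Unset Strict Implicit.
Unset Printing Implicit Defensive.

Import Order.TTheory GRing.Theory Num.Theory.

Local Open Scope classical_set_scope.
Local Open Scope ring_scope.

(** * The dot product and orthogonal complements *)

Section DotProduct.
Variables (R : realType) (p : nat).
Implicit Types (u v w : 'cV[R]_p) (W : {vspace 'cV[R]_p}).

Lemma dotvDr u v w : dotv u (v + w) = dotv u v + dotv u w.
Proof. by rewrite /dotv mulmxDr mxE. Qed.

Lemma dotvZr a u v : dotv u (a *: v) = a * dotv u v.
Proof. by rewrite /dotv -scalemxAr mxE. Qed.

Lemma dotvC u v : dotv u v = dotv v u.
Proof.
by rewrite /dotv !mxE; apply: eq_bigr => i _; rewrite !mxE mulrC.
Qed.

Lemma dotvBr u v w : dotv u (v - w) = dotv u v - dotv u w.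
Proof. by rewrite dotvDr -scaleN1r dotvZr mulN1r. Qed.

Lemma dotvBl u v w : dotv (u - v) w = dotv u w - dotv v w.
Proof. by rewrite !(dotvC _ w) dotvBr. Qed.

Lemma dotv0 u : dotv u 0 = 0.
Proof. by rewrite /dotv mulmx0 mxE. Qed.

Lemma dotvv_eq0 v : dotv v v = 0 -> v = 0.
Proof.
rewrite /dotv mxE => /eqP; rewrite psumr_eq0; last first.
  by move=> i _; rewrite mxE -expr2 sqr_ge0.
move=> /allP h; apply/matrixP => i j; rewrite (ord1 j) mxE.
by have := h i (mem_index_enum i); rewrite mxE mulf_eq0 orbb => /eqP.
Qed.

Definition dotv_seq (s : seq 'cV[R]_p) v : 'cV[R]_(size s) :=
  \col_i dotv s`_i v.

Lemma dotv_seq_linear s : linear (dotv_seq s).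
Proof.
by move=> a v w; apply/matrixP => i j; rewrite !mxE dotvDr dotvZr.
Qed.

HB.instance Definition _ s :=
  GRing.isLinear.Build R 'cV[R]_p 'cV[R]_(size s) _ (dotv_seq s)
    (dotv_seq_linear s).

Definition orthv W : {vspace 'cV[R]_p} := lker (linfun (dotv_seq (vbasis W))).

Lemma orthvP W v : reflect (forall w, w \in W -> dotv w v = 0) (v \in orthv W).
Proof.
rewrite memv_ker lfunE /=; apply: (iffP eqP) => [h w Ww|h].
  rewrite dotvC (coord_vbasis Ww).
  elim/big_ind: _ => [|x y x0 y0|i _]; first by rewrite dotv0.
    by rewrite dotvDr x0 y0 addr0.
  have lt_i : (i < size (vbasis W))%N by rewrite size_tuple.
  rewrite dotvZr dotvC.
  by move/matrixP/(_ (Ordinal lt_i) 0): h; rewrite !mxE /= => ->; rewrite mulr0.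
apply/matrixP => i j; rewrite !mxE.
by apply/h/vbasis_mem/mem_nth.
Qed.

(** One inequality is rank-nullity for the pairing against a basis of [W]; the
    other holds because a vector orthogonal to itself vanishes. *)
Lemma dim_orthv W : \dim (orthv W) = (p - \dim W)%N.
Proof.
have dimp : \dim {: 'cV[R]_p} = p by rewrite dimvf /dim /= muln1.
apply/eqP; rewrite eqn_leq; apply/andP; split.
  have capW : (W :&: orthv W)%VS = 0%VS.
    apply/eqP; rewrite -subv0; apply/subvP => v /memv_capP[Wv /orthvP/(_ v Wv)].
    by move/dotvv_eq0->; rewrite mem0v.
  have := dimvS (subvf (W + orthv W)).
  rewrite dimp dimv_disjoint_sum // => le.
  by rewrite -(leq_add2l (\dim W)) subnKC // (leq_trans (leq_addr _ _) le).
set f := linfun (dotv_seq (vbasis W)).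
have le : (\dim (limg f) <= \dim W)%N.
  by rewrite (leq_trans (dimvS (subvf _))) // dimvf /dim /= muln1 size_tuple.
have := limg_ker_dim f fullv; rewrite capfv -/(orthv W) dimp => {1}<-.
by rewrite leq_subLR addnC leq_add2r.
Qed.

Lemma orthvK W : orthv (orthv W) = W.
Proof.
apply/esym/eqP; rewrite eqEdim; apply/andP; split.
  by apply/subvP => w Ww; apply/orthvP => v /orthvP/(_ w Ww); rewrite dotvC.
rewrite !dim_orthv subKn //.
by have := dimvS (subvf W); rewrite dimvf /dim /= muln1.
Qed.

End DotProduct.

(** * Directions of linear spans and affine hulls *)

Section Hulls.
Variables (R : realType) (V : vectType R).
Implicit Types (A : set V) (W : {vspace V}).

Lemma flat_dim_lin A W :
    (forall x, A x -> x \in W) -> (forall w, w \in W -> lin A w) ->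
  flat_dim (lin A) = \dim W.
Proof.
move=> AW WA; rewrite -(flat_dim_translate 0 W); congr flat_dim.
apply/seteqP; split=> [x [n [a [v [Av ->]]]]|_ [w /= Ww <-]].
  exists (\sum_i a i *: v i); rewrite /= ?add0r //.
  by apply: memv_suml => i _; apply/memvZ/AW.
by rewrite add0r; apply: WA.
Qed.

Lemma aff_sub A : A `<=` aff A.
Proof.
move=> x Ax; exists 1%N, (fun=> 1), (fun=> x).
by rewrite !big_ord1 scale1r.
Qed.

(** The affine hull is already known to be flat, so its direction [U] only has
    to be compared with the span; both inclusions can be tested on
    differences of points, and the choice of base point cancels. *)
Lemma affine_dim_span A x0 (s : seq V) :
    A x0 -> (forall d, d \in s -> A (x0 + d)) ->
    (forall x, A x -> x - x0 \in <<s>>%VS) ->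
  affine_dim A = \dim <<s>>.
Proof.
move=> Ax0 sA As; have [|x [U affA]] := @aff_flat _ _ A; first by exists x0.
rewrite /affine_dim affA flat_dim_translate; congr (\dim _).
have aff_span y : aff A y -> y - x0 \in <<s>>%VS.
  move=> [n [a [v [Av a1 ->]]]].
  rewrite -[x0]scale1r -a1 scaler_suml -sumrB.
  by apply: memv_suml => i _; rewrite -scalerBr; apply/memvZ/As.
have tU y : y \in U -> aff A (x + y) by rewrite affA => Uy; exists y.
have Ut y : A y -> y - x \in U.
  by move/aff_sub; rewrite affA => -[z /= Uz <-]; rewrite addrC addKr.
apply: subv_anti; apply/andP; split.
  apply/subvP => y Uy.
  have -> : y = (x + y - x0) - (x + 0 - x0).
    by rewrite addr0 opprB addrA subrK addrC addKr.
  by apply: memvB; apply/aff_span/tU; rewrite ?mem0v.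
apply/span_subvP => d /sA Ad.
have -> : d = (x0 + d - x) - (x0 - x) by rewrite opprB addrA subrK addrC addKr.
by apply: memvB; apply: Ut.
Qed.

End Hulls.

(** * Active forms of a maximum of linear forms *)

Section Active.
Variables (R : realType) (p k : nat) (pen : 'cV[R]_p -> R).
Variable u : 'I_k.+1 -> 'cV[R]_p.
Hypothesis penE :
  forall b, pen b = \big[Num.max/dotv (u ord0) b]_(i < k.+1) dotv (u i) b.
Implicit Types (b v s : 'cV[R]_p).

Definition active b i := dotv (u i) b == pen b.

Lemma dotv_le_pen b i : dotv (u i) b <= pen b.
Proof. by rewrite penE; exact: (le_bigmax _ (fun j => dotv (u j) b)). Qed.

Lemma active_ex b : exists i, active b i.
Proof.
rewrite /active penE.
elim/big_ind: _ => [|x y [i /eqP <-] [j /eqP <-]|i _].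
- by exists ord0.
- by case: (leP (dotv (u i) b) (dotv (u j) b)) => _; [exists j|exists i].
- by exists i.
Qed.

Lemma pen_max b i : (forall j, dotv (u j) b <= dotv (u i) b) ->
  pen b = dotv (u i) b.
Proof.
move=> h; apply/le_anti; rewrite dotv_le_pen andbT.
by have [j /eqP <-] := active_ex b.
Qed.

Lemma pos_affine_small (I : finType) (P : pred I) (g h : I -> R) :
    (forall i, P i -> 0 < g i) ->
  exists2 e, 0 < e & forall t i, `|t| <= e -> P i -> 0 < g i + t * h i.
Proof.
(* the 1 keeps each denominator positive and makes the final bound strict *)
move=> g0; exists (\big[Num.min/1]_(i | P i) (g i / (1 + `|h i|))).
  apply: lt_bigmin => // i Pi; apply: divr_gt0; first exact: g0.
  by rewrite ltr_pwDl.
move=> t i te Pi; have h1 : 0 < 1 + `|h i| by rewrite ltr_pwDl.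
have : `|t| <= g i / (1 + `|h i|)
  by apply/(le_trans te)/(bigmin_le_cond _ (fun j => g j / _)).
rewrite ler_pdivlMr // => tg; rewrite -ltrBlDl sub0r.
have [->|t0] := eqVneq t 0; first by rewrite mul0r oppr_lt0 g0.
apply: lt_le_trans (lerNnormlW (lexx _)).
rewrite ltrN2 normrM; apply: lt_le_trans tg.
by rewrite mulrDr mulr1 ltrDr normr_gt0.
Qed.

(** The active forms move together, and the others lie strictly below them at
    [b], so they stay below for small [t]. *)
Lemma active_move b v c : (forall i, active b i -> dotv (u i) v = c) ->
  exists2 e, 0 < e & forall t, `|t| <= e ->
    pen (b + t *: v) = pen b + t * c /\ active (b + t *: v) = active b.
Proof.
move=> hc; have [i0 i0b] := active_ex b.
have [|e e0 he] := @pos_affine_small _ (fun i => ~~ active b i)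
  (fun i => pen b - dotv (u i) b) (fun i => c - dotv (u i) v).
  by move=> i nb; rewrite subr_gt0 lt_neqAle nb dotv_le_pen.
exists e => // t te.
have on i : active b i -> dotv (u i) (b + t *: v) = pen b + t * c.
  by move=> ib; rewrite dotvDr dotvZr (eqP ib) hc.
have off i : ~~ active b i -> dotv (u i) (b + t *: v) < pen b + t * c.
  move=> ib; have := he t i te ib.
  by rewrite mulrBr addrACA -opprD subr_gt0 dotvDr dotvZr.
have penv : pen (b + t *: v) = pen b + t * c.
  rewrite -(on _ i0b); apply: pen_max => j; rewrite (on _ i0b).
  by have [/on->|/off/ltW] := boolP (active b j).
split=> //; apply/funext => i; rewrite {1}/active penv.
have [/on->|/off/lt_eqF->//] := boolP (active b i); exact: eqxx.
Qed.

Lemma subgradient_active b i : subdifferential pen b (u i) <-> active b i.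
Proof.
split=> [/(_ 0)|/eqP ib z]; last first.
  by rewrite dotvBr ib addrC subrK dotv_le_pen.
have -> : pen 0 = 0 by have [j /eqP <-] := active_ex 0; rewrite dotv0.
rewrite dotvBr dotv0 sub0r subr_le0 => h.
by rewrite /active eq_le dotv_le_pen.
Qed.

(** With equal active sets, [pen] is affine on the line through [b] and [b']
    slightly beyond [b]; the subgradient inequality there forces [s] to touch
    [pen] at [b'] too. *)
Lemma subdifferential_active_sub b b' : active b = active b' ->
  subdifferential pen b `<=` subdifferential pen b'.
Proof.
move=> eb s sb z.
have [|e e0 /(_ e)] := @active_move b (b - b') (pen b - pen b').
  move=> i ib; have ib' : active b' i by rewrite -eb.
  by rewrite dotvBr (eqP ib) (eqP ib').
rewrite gtr0_norm // => /(_ (lexx _))[pene _].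
have := sb (b + e *: (b - b')); rewrite pene [b + _]addrC addrK.
rewrite dotvZr lerD2l ler_pM2l // => sbb'.
apply: le_trans (sb z); move: sbb'; rewrite !dotvBr; lra.
Qed.

Lemma pattern_class_active b b' :
  pattern_class pen b b' <-> active b' = active b.
Proof.
rewrite /pattern_class /=; split=> e; last first.
  by apply/seteqP; split; apply: subdifferential_active_sub.
apply/funext => i; apply/idP/idP => /subgradient_active h;
  by apply/subgradient_active; rewrite ?e // -e.
Qed.

Definition active_diffs b i0 :=
  [seq u i - u i0 | i <- enum 'I_k.+1 & active b i].

Lemma orthv_active_diffs b i0 v : active b i0 ->
  v \in orthv <<active_diffs b i0>> <->
  (forall i, active b i -> dotv (u i) v = dotv (u i0) v).
Proof.
move=> i0b; split=> [/orthvP h i ib|h].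
  apply/eqP; rewrite -subr_eq0 -dotvBl; apply/eqP/h/memv_span.
  by apply: map_f; rewrite mem_filter ib mem_enum.
have : (<<active_diffs b i0>> <= orthv <[v]>)%VS.
  apply/span_subvP => _ /mapP[i /[!mem_filter] /andP[ib _] ->].
  apply/orthvP => _ /vlineP[a ->].
  by rewrite dotvC dotvZr dotvBl h // subrr mulr0.
move=> /subvP sub; apply/orthvP => w /sub/orthvP/(_ v (memv_line v)).
by rewrite dotvC.
Qed.

(** Along a direction on which the active forms agree, [pen] is affine near
    [b] on both sides, so the subgradient inequality is an equality. *)
Lemma subgradient_sub b s i0 : active b i0 -> subdifferential pen b s ->
  s - u i0 \in <<active_diffs b i0>>%VS.
Proof.
move=> i0b sb; rewrite -[<<_>>%VS]orthvK; apply/orthvP => v.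
move=> /(orthv_active_diffs _ i0b)/active_move[e e0 he].
have bound t : `|t| <= e -> t * dotv s v <= t * dotv (u i0) v.
  move=> /he[pent _]; have := sb (b + t *: v).
  by rewrite pent [b + _]addrC addrK dotvZr lerD2l.
rewrite dotvC dotvBl; apply/eqP; rewrite subr_eq0 eq_le.
have := bound e; rewrite gtr0_norm // lexx ler_pM2l // => -> //=.
have := bound (- e); rewrite normrN gtr0_norm // lexx !mulNr lerN2.
by rewrite ler_pM2l // => ->.
Qed.

Lemma affine_dim_subdifferential b i0 : active b i0 ->
  affine_dim (subdifferential pen b) = \dim <<active_diffs b i0>>.
Proof.
move=> i0b; apply: (@affine_dim_span _ _ _ (u i0)).
- exact/subgradient_active.
- move=> _ /mapP[i /[!mem_filter] /andP[ib _] ->].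
  by rewrite addrC subrK; apply/subgradient_active.
- by move=> s; apply: subgradient_sub.
Qed.

Lemma complexity_orthv b i0 : active b i0 ->
  complexity pen b = \dim (orthv <<active_diffs b i0>>).
Proof.
move=> i0b; apply: flat_dim_lin => [x /pattern_class_active xb|v].
  apply/(orthv_active_diffs _ i0b) => i; rewrite -xb => /eqP->.
  by move: i0b; rewrite -xb => /eqP->.
move=> /(orthv_active_diffs _ i0b)/active_move[e e0 /(_ e)].
rewrite gtr0_norm // => /(_ (lexx _))[_ act].
(* v = e^-1 (b + e v) - e^-1 b, and both points are in the pattern class *)
exists 2%N, (fun i => if i == ord0 then e^-1 else - e^-1),
  (fun i => if i == ord0 then b + e *: v else b).
split=> [i|]; first by apply/pattern_class_active; case: ifP.
rewrite !big_ord_recl big_ord0 /= addr0 scaleNr -scalerBr addrC addKr.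
by rewrite scalerA mulVf ?scale1r ?gt_eqF.
Qed.

End Active.

Theorem corollary3p3 (R : realType) (p : nat) (pen : 'cV[R]_p -> R)
    (beta : 'cV[R]_p) (Hpen : polyhedral_gauge pen) :
  complexity pen beta = (p - affine_dim (subdifferential pen beta))%N.
Proof.
have [k [u [_ penE]]] := Hpen.
have [i0 i0b] := active_ex penE beta.
rewrite (complexity_orthv penE i0b) (affine_dim_subdifferential penE i0b).
exact: dim_orthv.
Qed.
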